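(* Let $\omega\in\mathbb{R}^{\mathbb{N}}$ be such that $1\le d:=\mathrm{rank}(\mathscr{R}_\omega)<\infty$. Then the Kronecker flow $(\mathbb{T}^{\mathbb{N}},\Phi_\omega)$ is topologically conjugate to another Kronecker flow $(\mathbb{T}^{\mathbb{N}},\Phi_{\tilde\omega})$ with $\tilde\omega=(0_d,\bar\omega)$, where $\bar\omega\in\mathbb{R}^{\mathbb{N}}$ is non-resonant and $0_d$ is the null vector in $\mathbb{R}^d$.
   Context: $\mathbb{N}=\{1,2,\dots\}$, $\mathbb{T}=\mathbb{R}/2\pi\mathbb{Z}$, and $\mathbb{T}^{\mathbb{N}}$ carries the product topology. For $\omega=(\omega_j)_{j\in\mathbb{N}}\in\mathbb{R}^{\mathbb{N}}$ the Kronecker flow is $\Phi_\omega^t(\theta)=(\Theta_j+\omega_jt+2\pi\mathbb{Z})_{j\in\mathbb{N}}$, where $\theta_j=\Theta_j+2\pi\mathbb{Z}$. $\mathbb{Z}^{(\mathbb{N})}$ is the group of finitely supported integer sequences. The resonance module $\mathscr{R}_\omega=\{\nu\in\mathbb{Z}^{(\mathbb{N})}:\sum_j\omega_j\nu_j=0\}$ is a free abelian group; $\omega$ is non-resonant if $\mathscr{R}_\omega=\{0\}$. $(0_d,\bar\omega)$ denotes concatenation: its first $d$ entries are $0$ and its $(d+j)$-th entry is $\bar\omega_j$. Two flows $\Phi,\Psi$ on $X,Y$ are topologically conjugate if there is a homeomorphism $h:X\to Y$ with $h\circ\Phi^t=\Psi^t\circ h$ for all $t\in\mathbb{R}$. 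*)

(* Defs.v *)
From HB Require Import structures.
From mathcomp Require Import all_boot all_order all_algebra generic_quotient.
From mathcomp Require Import all_classical all_reals all_analysis.
Set Implicit Arguments.
Unset Strict Implicit.
Unset Printing Implicit Defensive.
Import Order.TTheory GRing.Theory Num.Theory numFieldNormedType.Exports.
Local Open Scope classical_set_scope.
Local Open Scope ring_scope.
Local Open Scope quotient_scope.

(* The index set {1, 2, ...} is represented by nat: the entry of index j is
   stored at position j.-1. *)

Section Circle.
Variable R : realType.

Definition eq2pi (x y : R) : bool :=
  `[< exists k : int, x - y = 2 * pi * k%:~R >].

Lemma eq2pi_refl : reflexive eq2pi.
Proof. by move=> x; apply/asboolP; exists 0; rewrite subrr mulr0. Qed.

Lemma eq2pi_sym : symmetric eq2pi.
Proof.
suff H x y : eq2pi x y -> eq2pi y x by move=> x y; apply/idP/idP; apply: H.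
move=> /asboolP[k e]; apply/asboolP; exists (- k).
by rewrite mulrNz mulrN -e opprB.
Qed.

Lemma eq2pi_trans : transitive eq2pi.
Proof.
move=> y x z /asboolP[k e] /asboolP[l f]; apply/asboolP; exists (k + l).
by rewrite intrD mulrDr -e -f addrA subrK.
Qed.

Canonical eq2pi_equiv := EquivRel eq2pi eq2pi_refl eq2pi_sym eq2pi_trans.

End Circle.

Notation circle R := (quotient_topology {eq_quot (@eq2pi R)}).
Notation torus R := {ptws nat -> circle R}.

Definition int_finsupp : set (nat -> int) :=
  [set nu | finite_set [set j | nu j != 0]].

Section Kronecker.
Variable R : realType.

(* The representative of the class theta j is irrelevant: see kroneckerE. *)
Definition kronecker (omega : nat -> R) (t : R) (theta : torus R) : torus R :=
  fun j => \pi_(circle R) (repr (theta j) + omega j * t).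

Lemma kroneckerE omega t (Theta : nat -> R) :
  kronecker omega t (fun j => \pi_(circle R) (Theta j)) =
  (fun j => \pi_(circle R) (Theta j + omega j * t)).
Proof.
apply/funext => j; rewrite /kronecker.
have /eqmodP/asboolP[k e] :
    repr (\pi_(circle R) (Theta j)) = Theta j %[mod {eq_quot (@eq2pi R)}].
  exact: reprK.
apply/eqmodP/asboolP; exists k.
by rewrite -e opprD addrACA subrr addr0.
Qed.

(* For nu in int_finsupp the sum below has finitely many nonzero terms, hence
   the finitely supported iterated sum is the actual sum. *)
Definition resonance_module (omega : nat -> R) : set (nat -> int) :=
  [set nu | int_finsupp nu /\
            \sum_(j \in [set: nat]) omega j * (nu j)%:~R = 0].

Definition non_resonant (omega : nat -> R) : Prop :=
  resonance_module omega = [set 0].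

Definition zero_cat (d : nat) (omega : nat -> R) : nat -> R :=
  fun j => if (j < d)%N then 0 else omega (j - d)%N.

End Kronecker.

Definition int_basis (V : zmodType) (A : set V) (d : nat) (b : 'I_d -> V) :=
  (forall c : 'I_d -> int, \sum_i b i *~ c i = 0 -> forall i, c i = 0) /\
  A = [set \sum_i b i *~ c i | c in [set: 'I_d -> int]].

(* The subgroup A is free abelian of (finite) rank d. *)
Definition has_rank (V : zmodType) (A : set V) (d : nat) : Prop :=
  exists b : 'I_d -> V, int_basis A b.

Definition homeomorphism (X Y : topologicalType) (h : X -> Y) : Prop :=
  exists g : Y -> X,
    [/\ cancel h g, cancel g h, continuous h & continuous g].

Definition topologically_conjugate (T : Type) (X Y : topologicalType)
    (Phi : T -> X -> X) (Psi : T -> Y -> Y) : Prop :=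
  exists2 h : X -> Y, homeomorphism h & forall t, h \o Phi t = Psi t \o h.

(* Main.v *)
Require Import Defs.
From HB Require Import structures.
From mathcomp Require Import all_boot all_order all_algebra generic_quotient.
From mathcomp Require Import all_classical all_reals all_analysis.
Import Order.TTheory GRing.Theory Num.Theory numFieldNormedType.Exports.
Local Open Scope classical_set_scope.
Local Open Scope ring_scope.

(** The resonance module M has a finite basis, and each basis vector has
    finite support, so M lies in Z^n for some n.  It is saturated there: if
    k nu is a resonance with k <> 0, so is nu.  A saturated subgroup of Z^n is
    spanned by the first d rows of some unimodular matrix U; here U is read off
    from the Smith normal form of the matrix of the given basis
    (adapted_unimodular), and saturation is what makes the rows of U
    themselves, and not only multiples of them, resonances
    (adapted_coordinates).

    Let U act on the first n coordinates of a sequence and fix the others.  On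
    real sequences this action preserves the lattice 2 pi Z^N, hence it induces
    a map of the torus, with inverse induced by U^-1; it is continuous because
    each coordinate depends on finitely many angles
    (torus_mx_homeomorphism).  By linearity it carries the flow of omega to the
    flow of U omega (torus_mx_kronecker).

    The first d entries of U omega are the pairings of omega with the first d
    rows of U, which are resonances, so they vanish.  If nu is a resonance of
    the remaining entries, then (0_d, nu) is a resonance of U omega, and by
    duality (pairing_mxact) U^T (0_d, nu) is a resonance of omega, that is, a
    combination of the first d rows of U.  As U is invertible, (0_d, nu) is
    supported in the first d coordinates, and nu = 0. *)

(** * Unimodular matrices adapted to a free family of integer vectors *)

(** With B = L D U in Smith normal form, freeness of the rows makes the d
    diagonal entries of D nonzero.  The row space of B is then contained in the
    span of the first d rows of U, since L D has zero columns beyond the d-th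
    one, and contains a nonzero multiple of each of them, since
    L^-1 B = D U. *)
Lemma adapted_unimodular (d m : nat) (B : 'M[int]_(d, d + m)) :
  (forall c : 'rV_d, c *m B = 0 -> c = 0) ->
  exists2 U : 'M[int]_(d + m), U \in unitmx &
    (forall c : 'rV_d, exists e : 'rV_d, c *m B = row_mx e 0 *m U) /\
    (forall i : 'I_d, exists2 k : int, k != 0 &
       exists c : 'rV_d, c *m B = k *: row (lshift m i) U).
Proof.
move=> freeB; have [L uL [U uU [s _ BE]]] := int_Smith_normal_form B.
have DE : (\matrix_(i, j) (s`_i *+ (i == j :> nat)) : 'M[int]_(d, d + m)) =
          row_mx (diag_mx (\row_(i < d) s`_i)) 0.
  apply/matrixP => i j; rewrite mxE.
  case: (split_ordP j) => j' ->; rewrite ?row_mxEl ?row_mxEr !mxE //=.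
  by rewrite ltn_eqF // ltn_addr.
exists U => //; split=> [c | i].
  exists (c *m L *m diag_mx (\row_(i < d) s`_i)).
  by rewrite BE DE !mulmxA mul_mx_row mulmx0.
have cB : row i (invmx L) *m B = s`_i *: row (lshift m i) U.
  rewrite BE DE 2!mulmxA -row_mul mulVmx // -row_mul mul1mx.
  rewrite [row (lshift m i) U]rowE scalemxAl; congr (_ *m _).
  apply/rowP => j; rewrite !mxE.
  case: (split_ordP j) => j' ->; rewrite ?row_mxEl ?row_mxEr !mxE /=.
    by rewrite eq_lshift mulr_natr eq_sym.
  by rewrite eq_rlshift mulr0.
exists s`_i; last by exists (row i (invmx L)).
(* A zero diagonal entry would make this row of L^-1, hence of 1, vanish. *)
apply/eqP => s0; have /freeB c0 : row i (invmx L) *m B = 0.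
  by rewrite cB s0 scale0r.
have := congr1 (row i) (mulVmx uL).
by rewrite row_mul c0 mul0mx => /rowP/(_ i); rewrite !mxE eqxx.
Qed.

(** * Integer matrices acting on sequences *)

Section SequenceAction.
Context {V : zmodType} {n : nat}.
Implicit Types (U W : 'M[int]_n) (x : nat -> V).

(** The action of the block matrix diag(U, 1, 1, ...).  The entries lie in any
    abelian group, as the action is needed on real sequences (frequencies and
    lifts of angles) and on integer ones (resonances). *)
Definition mxact U x (j : nat) : V :=
  if insub j is Some i then \sum_(k < n) x k *~ U i k else x j.

Lemma mxact_ord U x (i : 'I_n) : mxact U x i = \sum_(k < n) x k *~ U i k.
Proof. by rewrite /mxact valK. Qed.

Lemma mxact_ge U x j : (n <= j)%N -> mxact U x j = x j.
Proof. by move=> nj; rewrite /mxact insubF // ltnNge nj. Qed.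

Lemma mxactM U W x : mxact U (mxact W x) = mxact (U *m W) x.
Proof.
apply/funext => j; have [nj|jn] := leqP n j; first by rewrite !mxact_ge.
rewrite -[j]/(val (Ordinal jn)) !mxact_ord.
under eq_bigr => k _ do rewrite mxact_ord mulrz_suml.
rewrite exchange_big; apply: eq_bigr => l _; rewrite mxE mulrz_sumr.
by apply: eq_bigr => k _; rewrite mulrC mulrzA.
Qed.

Lemma mxact1 x : mxact 1%:M x = x.
Proof.
apply/funext => j; have [nj|jn] := leqP n j; first by rewrite mxact_ge.
rewrite -[j]/(val (Ordinal jn)) mxact_ord (bigD1 (Ordinal jn)) //= mxE eqxx.
rewrite big1 ?addr0 // => k kj; rewrite mxE eq_sym (negbTE kj) mulr0z //.
Qed.

Lemma mxactD U x y : mxact U (x \+ y) = mxact U x \+ mxact U y.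
Proof.
apply/funext => j /=; have [nj|jn] := leqP n j; first by rewrite !mxact_ge.
rewrite -[j]/(val (Ordinal jn)) !mxact_ord -big_split.
by apply: eq_bigr => k _; rewrite mulrzDl.
Qed.

End SequenceAction.

Lemma mxactMr (V : pzRingType) n (U : 'M[int]_n) (x : nat -> V) t :
  mxact U (fun j => x j * t) = (fun j => mxact U x j * t).
Proof.
apply/funext => j; have [nj|jn] := leqP n j; first by rewrite !mxact_ge.
rewrite -[j]/(val (Ordinal jn)) !mxact_ord mulr_suml.
by apply: eq_bigr => k _; rewrite mulrzAl.
Qed.

Lemma finsupp_bounded (nu : nat -> int) :
  int_finsupp nu <-> exists M, forall j, (M <= j)%N -> nu j = 0.
Proof.
split=> [/finite_seqP[s sE]|[M nu0]].
  exists (\max_(k <- s) k).+1 => j sj; apply/eqP/negPn/negP => nuj.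
  have js : j \in s by move/seteqP: sE => -[+ _]; apply.
  by move: sj; rewrite ltnNge (big_rem _ js) /= leq_maxl.
apply: (sub_finite_set _ (finite_II M)) => j /= nuj.
by rewrite ltnNge; apply: contra nuj => /nu0 ->.
Qed.

(** * Duality between frequencies and finitely supported sequences *)

Section Pairing.
Context {R : realType}.
Implicit Types (omega : nat -> R) (nu : nat -> int).

Definition pairing omega nu : R :=
  \sum_(j \in [set: nat]) omega j * (nu j)%:~R.

Lemma pairing_ord omega nu M : (forall j, (M <= j)%N -> nu j = 0) ->
  pairing omega nu = \sum_(j < M) omega j * (nu j)%:~R.
Proof.
move=> nu0; rewrite (fsbig_ord _ _ (fun j => omega j * (nu j)%:~R)).
apply/esym/fsbig_widen => // j [_ /=] /negP; rewrite -leqNgt => /nu0 ->.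
by rewrite mulr0.
Qed.

Lemma mxact_finsupp n (U : 'M[int]_n) nu :
  int_finsupp nu -> int_finsupp (mxact U nu).
Proof.
move=> /finsupp_bounded[M nu0]; apply/finsupp_bounded; exists (n + M)%N => j.
by move=> nMj; rewrite mxact_ge ?nu0 //; apply: leq_trans nMj;
  rewrite (leq_addl, leq_addr).
Qed.

(** Resonances of U omega correspond, through the transpose, to resonances of
    omega. *)
Lemma pairing_mxact n (U : 'M[int]_n) omega nu : int_finsupp nu ->
  pairing (mxact U omega) nu = pairing omega (mxact U^T nu).
Proof.
move=> /finsupp_bounded[M nu0].
have nu0' j : (n + M <= j)%N -> nu j = 0.
  by move=> nMj; apply/nu0/(leq_trans _ nMj)/leq_addl.
rewrite !(@pairing_ord _ _ (n + M)) //; last first.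
  move=> j nMj; rewrite mxact_ge ?nu0' //.
  exact: leq_trans (leq_addr _ _) nMj.
rewrite !big_split_ord /=; congr (_ + _); last first.
  by apply: eq_bigr => j _; rewrite !mxact_ge ?leq_addr.
under eq_bigr => i _ do rewrite mxact_ord mulr_suml.
under [RHS]eq_bigr => i _ do rewrite mxact_ord rmorph_sum mulr_sumr.
rewrite exchange_big; apply: eq_bigr => k _; apply: eq_bigr => i _.
by rewrite mxE raddfMz mulrzAl -mulrzAr.
Qed.

End Pairing.

(** * Toral homeomorphisms induced by unimodular matrices *)

Section Torus.
Context {R : realType}.
Local Open Scope quotient_scope.

Lemma circle_eqP (x y : R) :
  \pi_(circle R) x = \pi_(circle R) y <->
  exists k : int, x - y = 2 * pi * k%:~R.
Proof.
split=> [/eqmodP/asboolP //|xy]; exact/eqmodP/asboolP.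
Qed.

(** The projection of the line onto the circle is open, because the saturation
    of a set is a union of its translates.  This is how neighbourhoods in the
    torus, whose topology is a product of quotient topologies, are obtained from
    intervals of lifts. *)
Lemma nbhs_pi_circle (x : R) (A : set R) :
  nbhs x A -> nbhs (\pi_(circle R) x) [set \pi_(circle R) y | y in A].
Proof.
rewrite nbhsE => -[A' [oA' A'x] A'A].
rewrite nbhsE; exists [set \pi_(circle R) y | y in A']; last first.
  exact: image_subset.
split; last by exists x.
rewrite /open /= /quotient_open openE => y [z A'z /circle_eqP[k zy]].
have : (fun t : R => t + 2 * pi * k%:~R) @ y --> y + 2 * pi * k%:~R.
  by apply: cvgD => //; exact: cvg_cst.
have -> : y + 2 * pi * k%:~R = z by rewrite -zy addrC subrK.
have nA' : nbhs z A' by exact: open_nbhs_nbhs.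
move=> /(_ A' nA') nyA'.
suff : \forall t \near y, exists2 u, A' u & \pi_(circle R) u = \pi_(circle R) t.
  by [].
near=> t; exists (t + 2 * pi * k%:~R); first by near: t.
by apply/circle_eqP; exists k; rewrite addrAC subrr add0r.
Unshelve. all: by end_near.
Qed.

Definition pi_torus (x : nat -> R) : torus R := fun j => \pi_(circle R) (x j).

Definition torus_mx {n} (U : 'M[int]_n) (theta : torus R) : torus R :=
  fun j => \pi_(circle R) (mxact U (fun k => repr (theta k)) j).

(** Changing the lift by a sequence 2 pi l changes the image by 2 pi (U l), as
    U has integer entries. *)
Lemma torus_mxE n (U : 'M[int]_n) (x : nat -> R) :
  torus_mx U (pi_torus x) = pi_torus (mxact U x).
Proof.
apply/funext => j; rewrite /torus_mx /pi_torus; apply/circle_eqP.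
have ex k : exists l : int,
    repr (\pi_(circle R) (x k)) - x k = 2 * pi * l%:~R.
  by apply/circle_eqP; rewrite reprK.
have [l lE] := choice ex.
exists (mxact U l j); have [nj|jn] := leqP n j.
  by rewrite !mxact_ge // lE.
rewrite -[j]/(val (Ordinal jn)) !mxact_ord -sumrB rmorph_sum mulr_sumr.
by apply: eq_bigr => k _; rewrite -mulrzBl lE raddfMz -mulrzAr.
Qed.

Lemma torus_lift (theta : torus R) :
  exists x : nat -> R, theta = pi_torus x.
Proof.
exists (fun j => repr (theta j)).
by apply/funext => j; rewrite /pi_torus reprK.
Qed.

Lemma continuous_ptws (X Y : topologicalType) (f : X -> {ptws nat -> Y}) :
  (forall j, continuous (fun x => f x j)) -> continuous f.
Proof.
move=> cf x; apply/cvg_sup => j.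
exact: (@continuous_comp_initial _ _ _ (fun g : nat -> Y => g j) f (cf j)).
Qed.

(** For j < n the j-th coordinate is the class of sum_k U_jk x_k, for any lift
    x.  This sum moves by less than e when the first n angles have lifts
    within e / S of those of x, where S exceeds the sum of the |U_jk|. *)
Lemma torus_mx_continuous n (U : 'M[int]_n) : continuous (torus_mx U).
Proof.
apply: continuous_ptws => j theta.
have [nj|jn] := leqP n j.
  have -> : (fun x => torus_mx U x j) = proj j.
    by apply/funext => z; rewrite /torus_mx mxact_ge // reprK.
  exact: proj_continuous.
have [x ->] := torus_lift theta.
move=> A; rewrite torus_mxE => /pi_continuous /=.
rewrite -[j]/(val (Ordinal jn)) mxact_ord.
set i := Ordinal jn => /nbhs_ballP[e /= e0 eA].
pose S : R := 1 + \sum_(k < n) `|(U i k)%:~R|.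
have S0 : 0 < S by rewrite ltr_pwDl // sumr_ge0.
have pi_ball (k : 'I_n) : \forall phi \near (pi_torus x),
    exists2 y, ball (x k) (e / S) y & \pi_(circle R) y = (phi : torus R) k.
  have Bk : nbhs (pi_torus x k)
      [set \pi_(circle R) y | y in ball (x k) (e / S)].
    exact/nbhs_pi_circle/nbhsx_ballx/divr_gt0.
  exact: (@proj_continuous nat (fun=> circle R) k (pi_torus x) _ Bk).
suff : \forall phi \near pi_torus x, A (torus_mx U phi j) by [].
near=> phi.
have /choice[y yP] : forall k : 'I_n, exists y,
    ball (x k) (e / S) y /\ \pi_(circle R) y = phi k.
  move=> k; suff [z zP zE] : exists2 y, ball (x k) (e / S) y &
    \pi_(circle R) y = phi k by exists z.
  by move: k; near: phi; apply: filter_forall.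
(* A lift of phi that is close to x on the first n coordinates. *)
pose Y j := if insub j is Some k then y k else repr (phi j).
have -> : phi = pi_torus Y.
  apply/funext => l; rewrite /pi_torus /Y; case: insubP => [k _ <-|_].
    by rewrite (yP k).2.
  by rewrite reprK.
rewrite torus_mxE /pi_torus -[j]/(val i) mxact_ord; apply: eA.
rewrite /ball /= -sumrB (le_lt_trans (ler_norm_sum _ _ _)) //.
apply: (@le_lt_trans _ _ (\sum_k e / S * `|(U i k)%:~R|)).
  apply: ler_sum => k _; rewrite -mulrzBl -mulrzr normrM ler_wpM2r //.
  by rewrite /Y valK ltW // (yP k).1.
rewrite -mulr_sumr -[ltRHS](divfK (lt0r_neq0 S0)) ltr_pM2l ?divr_gt0 //.
by rewrite ltrDr.
Unshelve. all: by end_near.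
Qed.

Lemma torus_mxM n (U W : 'M[int]_n) (theta : torus R) :
  torus_mx U (torus_mx W theta) = torus_mx (U *m W) theta.
Proof. by have [x ->] := torus_lift theta; rewrite !torus_mxE mxactM. Qed.

Lemma torus_mx1 n (theta : torus R) : torus_mx (1%:M : 'M[int]_n) theta = theta.
Proof. by have [x ->] := torus_lift theta; rewrite torus_mxE mxact1. Qed.

Lemma torus_mx_homeomorphism n (U : 'M[int]_n) :
  U \in unitmx -> homeomorphism (torus_mx U).
Proof.
move=> uU; exists (torus_mx (invmx U)); split; do ?exact: torus_mx_continuous.
- by move=> theta; rewrite torus_mxM mulVmx // torus_mx1.
- by move=> theta; rewrite torus_mxM mulmxV // torus_mx1.
Qed.

Lemma torus_mx_kronecker n (U : 'M[int]_n) (omega : nat -> R) t :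
  torus_mx U \o kronecker omega t = kronecker (mxact U omega) t \o torus_mx U.
Proof.
apply/funext => theta /=; have [x ->] := torus_lift theta.
by rewrite torus_mxE !kroneckerE torus_mxE mxactD mxactMr.
Qed.

End Torus.

(** * Coordinates in which the resonances are the first ones *)

Section Resonance.
Context {R : realType}.
Implicit Types (omega : nat -> R) (nu : nat -> int).

Definition shift_right (d : nat) nu : nat -> int :=
  fun j => if (j < d)%N then 0 else nu (j - d)%N.

Lemma shift_finsupp d nu : int_finsupp nu -> int_finsupp (shift_right d nu).
Proof.
move=> /finsupp_bounded[M nu0]; apply/finsupp_bounded; exists (d + M)%N => j.
move=> dMj; rewrite /shift_right; case: ifP => // _.
by rewrite nu0 // leq_subRL // (leq_trans _ dMj) // leq_addr.
Qed.

Lemma pairing_shift d omega nu : int_finsupp nu ->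
  pairing (zero_cat d omega) (shift_right d nu) = pairing omega nu.
Proof.
move=> nu_fin; have /finsupp_bounded[M nu0] := nu_fin.
rewrite (pairing_ord omega nu M) // (pairing_ord _ _ (d + M)); last first.
  move=> j dMj; rewrite /shift_right ifN ?nu0 // -?leqNgt ?leq_subRL //;
    exact: leq_trans (leq_addr _ _) dMj.
rewrite big_split_ord /= big1 ?add0r => [|j _]; last first.
  by rewrite /zero_cat ltn_ord mul0r.
apply: eq_bigr => j _.
by rewrite /zero_cat /shift_right ltnNge leq_addr /= addKn.
Qed.

Lemma lincombE (d : nat) (b : 'I_d -> nat -> int) (c : 'I_d -> int) j :
  (\sum_i b i *~ c i) j = \sum_i b i j * c i.
Proof.
rewrite fct_sumE; apply: eq_bigr => i _.
have natmulE k : (b i *+ k) j = b i j *+ k.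
  by elim: k => // k IH; rewrite !mulrS -IH.
rewrite -mulrzz; case: (c i) => k; first exact: natmulE.
by congr (- _); apply: natmulE.
Qed.

Lemma basis_mem (d : nat) (A : set (nat -> int)) (b : 'I_d -> nat -> int) i :
  int_basis A b -> A (b i).
Proof.
move=> [_ ->]; exists (fun k => (k == i)%:Z) => //.
by rewrite (bigD1 i) //= eqxx big1 ?addr0 // => k /negPf ->.
Qed.

Lemma common_support (d : nat) (b : 'I_d -> nat -> int) :
  (forall i, int_finsupp (b i)) ->
  exists m, forall i j, (d + m <= j)%N -> b i j = 0.
Proof.
move=> b_fin; have /choice[M b0] : forall i,
    exists M, forall j, (M <= j)%N -> b i j = 0.
  by move=> i; apply/finsupp_bounded.
exists (\max_i M i) => i j dMj; apply: b0.
apply: leq_trans (leq_trans (leq_addl _ _) dMj).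
exact: leq_bigmax.
Qed.

(** Each of the first d rows of U has a nonzero multiple in the resonance
    module, and a real number with a vanishing nonzero multiple is zero; this
    gives the first part of the conclusion.  The second one says that a
    sequence nu can only make U^T nu a resonance if it is supported in the first
    d coordinates, because the resonances are combinations of these rows. *)
Lemma adapted_coordinates omega (d : nat) :
  has_rank (resonance_module omega) d ->
  exists m, exists2 U : 'M[int]_(d + m), U \in unitmx &
    (forall i, (i < d)%N -> mxact U omega i = 0) /\
    (forall nu, resonance_module omega (mxact U^T nu) ->
      forall j, (d <= j)%N -> nu j = 0).
Proof.
move=> [b bP]; have b_mem i := basis_mem _ _ _ i bP.
have [m b0] : exists m, forall i j, (d + m <= j)%N -> b i j = 0.
  by apply: common_support => i; case: (b_mem i).
have [b_free bE] := bP.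
pose B := \matrix_(i < d, j < d + m) b i j.
have BE (c : 'rV_d) (j : 'I_(d + m)) : (c *m B) 0 j = (\sum_i b i *~ c 0 i) j.
  by rewrite lincombE mxE; apply: eq_bigr => i _; rewrite mxE mulrC.
have [c cB|U uU [span dvd]] := @adapted_unimodular d m B.
  have {}cB : \sum_i b i *~ c 0 i = 0.
    apply/funext => j; have [dmj|jdm] := leqP (d + m) j.
      by rewrite lincombE big1 // => i _; rewrite b0 ?mul0r.
    by rewrite -[j]/(val (Ordinal jdm)) -BE cB mxE.
  by apply/rowP => i; rewrite (b_free _ cB) mxE.
exists m, U => //; split=> [i lt_id|nu].
  have [k k0 [c cB]] := dvd (Ordinal lt_id).
  have : resonance_module omega (\sum_i b i *~ c 0 i).
    by rewrite bE; exists (c 0).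
  move=> [_]; rewrite -/(pairing _ _) (pairing_ord _ _ (d + m)); last first.
    by move=> j dmj; rewrite lincombE big1 // => l _; rewrite b0 ?mul0r.
  rewrite -[i]/(val (lshift m (Ordinal lt_id))) mxact_ord => ck.
  apply/eqP; rewrite -[_ == 0]/(false || _) -(negPf k0) -mulrz_eq0.
  rewrite mulrz_suml -[X in _ == X]ck; apply/eqP/eq_bigr => j _.
  by rewrite -BE cB !mxE -mulrzA [k * _]mulrC mulrzr.
rewrite bE => -[c _ cE] j dj.
(* Beyond d + m the matrix acts trivially and all resonances vanish. *)
have [dmj|jdm] := leqP (d + m) j.
  rewrite -(mxact_ge U^T nu j dmj) -cE lincombE big1 // => i _.
  by rewrite b0 ?mul0r.
have [e eE] := span (\row_i c i).
pose v : 'rV_(d + m) := \row_k nu k.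
have : v *m U = row_mx e 0 *m U.
  rewrite -eE; apply/rowP => k; rewrite BE.
  under eq_bigr => i _ do rewrite mxE.
  rewrite cE mxact_ord mxE; apply: eq_bigr => l _.
  by rewrite !mxE -mulrzr intz.
move/(congr1 (mulmx^~ (invmx U))); rewrite !mulmxK //.
move/rowP/(_ (Ordinal jdm)); rewrite mxE /= => ->.
case: (split_ordP (Ordinal jdm)) => k kE; rewrite kE ?row_mxEr ?mxE //.
by move: dj; rewrite leqNgt -[j]/(val (Ordinal jdm)) kE /= ltn_ord.
Qed.

Lemma resonance0 omega : resonance_module omega 0.
Proof.
split; first by apply/finsupp_bounded; exists 0%N.
by rewrite fsbig1 // => j _; rewrite mulr0.
Qed.

End Resonance.

Theorem proposition2p13 (R : realType) (omega : nat -> R) (d : nat)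
    (d_ge1 : (1 <= d)%N)
    (rank_omega : has_rank (resonance_module omega) d) :
  exists omegabar : nat -> R,
    non_resonant omegabar /\
    topologically_conjugate (kronecker omega)
                            (kronecker (zero_cat d omegabar)).
Proof.
have [m [U uU [omega0 nonres]]] := adapted_coordinates omega d rank_omega.
pose omegabar j := mxact U omega (d + j)%N.
have omegabarE : zero_cat d omegabar = mxact U omega.
  apply/funext => j; rewrite /zero_cat /omegabar.
  by case: ltnP => [/omega0->|dj] //; rewrite subnKC.
exists omegabar; split; last first.
  rewrite omegabarE; exists (torus_mx U); first exact: torus_mx_homeomorphism.
  exact: torus_mx_kronecker.
apply/seteqP; split=> [nu [nu_fin nu0]|_ ->]; last exact: resonance0.
apply/funext => j.
suff : shift_right d nu (d + j) = 0.
  by rewrite /shift_right ltnNge leq_addr /= addKn.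
apply: nonres; last exact: leq_addr.
split; first exact/mxact_finsupp/shift_finsupp.
rewrite -/(pairing _ _) -pairing_mxact; last exact: shift_finsupp.
by rewrite -omegabarE pairing_shift.
Qed.
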